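(* Let $\Lambda$ be a row-finite $2$-graph with no sources and let $H\subseteq\Lambda^0$ be a saturated hereditary subset. There is a homomorphism $\tilde\iota:\operatorname{coker}(1-A_{H,1}^t,1-A_{H,2}^t)\to\operatorname{coker}(1-A_1^t,1-A_2^t)$ such that $\tilde\iota(f+\operatorname{im}(1-A_{H,1}^t,1-A_{H,2}^t))=f+\operatorname{im}(1-A_1^t,1-A_2^t)$ for all $f\in\mathbb{Z}H$. If $\Lambda$ satisfies condition (M), then $H\Lambda$ satisfies condition (M) and $$\ker(\tilde\iota)\cap\big[\mathbb{N}H+\operatorname{im}(1-A_{H,1}^t,1-A_{H,2}^t)\big]=\{0\}.\qquad( * )$$ Conversely, if $\Lambda\setminus\Lambda H$ and $H\Lambda$ both satisfy condition (M) and $( * )$ holds, then $\Lambda$ satisfies condition (M).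
   Context: $\mathbb{N}=\{0,1,2,\dots\}$. A $k$-graph is a countable category $\Lambda$ with a functor $d:\Lambda\to\mathbb{N}^k$ ($\mathbb{N}^k$ regarded as a one-object category) with the factorisation property: if $d(\lambda)=m+n$ there are unique $\mu\in d^{-1}(m)$, $\nu\in d^{-1}(n)$ with $\lambda=\mu\nu$. Write $\Lambda^n=d^{-1}(n)$; $\Lambda^0$ is the set of identity morphisms, identified with the objects (vertices); $r,s:\Lambda\to\Lambda^0$ are the codomain and domain maps. For $v,w\in\Lambda^0$, $v\Lambda^n=\Lambda^n\cap r^{-1}(v)$ and $v\Lambda^nw=v\Lambda^n\cap s^{-1}(w)$; for $H\subseteq\Lambda^0$, $H\Lambda=r^{-1}(H)$ and $\Lambda H=s^{-1}(H)$. $\Lambda$ is row-finite if every $v\Lambda^n$ is finite and has no sources if every $v\Lambda^n$ is nonempty. The adjacency matrices are $A_i(v,w)=|v\Lambda^{e_i}w|$ ($e_i$ the generators of $\mathbb{N}^k$). The transpose $A_i^t$ is regarded as the endomorphism of the free abelian group $\mathbb{Z}\Lambda^0$ (basis $\{\delta_v\}$) with $A_i^t\delta_v=\sum_w|v\Lambda^{e_i}w|\delta_w$. $\mathbb{N}\Lambda^0\subseteq\mathbb{Z}\Lambda^0$ is the set of finite nonnegative-integer combinations of the $\delta_v$. $H\subseteq\Lambda^0$ is hereditary if $s(H\Lambda)\subseteq H$, and saturated if whenever $v\in\Lambda^0$ and $n\in\mathbb{N}^k$ satisfy $s(v\Lambda^n)\subseteq H$ we have $v\in H$. If $H$ is saturated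 and hereditary, then $H\Lambda$ and $\Lambda\setminus\Lambda H$ are sub-$k$-graphs of $\Lambda$, with vertex sets $H$ and $\Lambda^0\setminus H$, and both are row-finite with no sources. $A_{H,i}$ are the adjacency matrices of $H\Lambda$; $A_{H,i}^t$ is the restriction of $A_i^t$ to $\mathbb{Z}H\subseteq\mathbb{Z}\Lambda^0$. $(1-A_1^t,1-A_2^t)$ is the homomorphism $\mathbb{Z}\Lambda^0\oplus\mathbb{Z}\Lambda^0\to\mathbb{Z}\Lambda^0$, $(f,g)\mapsto(1-A_1^t)f+(1-A_2^t)g$, and similarly for $H\Lambda$. The set $\mathbb{N}H+\operatorname{im}(1-A_{H,1}^t,1-A_{H,2}^t)$ is the image of $\mathbb{N}H$ in $\operatorname{coker}(1-A_{H,1}^t,1-A_{H,2}^t)$. A row-finite $2$-graph $\Gamma$ with no sources and adjacency matrices $A_1,A_2$ satisfies condition (M) if $\{(1-A_1^t)f+(1-A_2^t)g:f,g\in\mathbb{Z}\Gamma^0\}\cap\mathbb{N}\Gamma^0=\{0\}$. *)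

(* Defs.v *)
From HB Require Import structures.
From mathcomp Require Import all_boot all_order all_algebra finmap.
From mathcomp Require Import boolp classical_sets functions cardinality fsbigop.
From mathcomp Require Import freeg.

Set Implicit Arguments.
Unset Strict Implicit.
Unset Printing Implicit Defensive.

Import Order.TTheory GRing.Theory Num.Theory.

Local Open Scope classical_set_scope.
Local Open Scope ring_scope.
Local Open Scope quotient_scope.

(* Composition is partial: for e : src f = rng g, [compose e] is the          *)
(* composite f g, i.e. f after g. Countability is carried by the types.       *)
Record category := Category {
  ob : countType;
  mor : countType;
  rng : mor -> ob;
  src : mor -> ob;
  idm : ob -> mor;
  compose : forall f g : mor, src f = rng g -> mor;
  rng_id : forall v, rng (idm v) = v;
  src_id : forall v, src (idm v) = v;
  rng_comp : forall f g (e : src f = rng g), rng (compose e) = rng f;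
  src_comp : forall f g (e : src f = rng g), src (compose e) = src g;
  comp_idl : forall f (e : src (idm (rng f)) = rng f), compose e = f;
  comp_idr : forall f (e : src f = rng (idm (src f))), compose e = f;
  comp_assoc : forall f g h (fg : src f = rng g) (gh : src g = rng h)
    (fgh : src (compose fg) = rng h) (fgh' : src f = rng (compose gh)),
    compose fgh = compose fgh' }.

Record kgraph (k : nat) := KGraph {
  kgraph_cat :> category;
  degree : mor kgraph_cat -> 'rV[nat]_k;
  deg_id : forall v, degree (idm v) = 0;
  deg_comp : forall f g (e : src f = rng g),
    degree (compose e) = degree f + degree g;
  factorisation : forall (l : mor kgraph_cat) (m n : 'rV[nat]_k),
    degree l = m + n ->
    exists! p : mor kgraph_cat * mor kgraph_cat,
      [/\ degree p.1 = m, degree p.2 = n &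
          exists e : src p.1 = rng p.2, compose e = l] }.

Section PathSets.
Variables (k : nat) (L : kgraph k).
Implicit Types (v w : ob L) (n : 'rV[nat]_k) (H : set (ob L)).

Definition paths_from v n : set (mor L) := [set l | degree l = n /\ rng l = v].

Definition paths_between v n w : set (mor L) :=
  paths_from v n `&` [set l | src l = w].

Definition range_in H : set (mor L) := @rng L @^-1` H.
Definition source_in H : set (mor L) := @src L @^-1` H.

Definition row_finite := forall v n, finite_set (paths_from v n).
Definition no_sources := forall v n, paths_from v n !=set0.

Definition hereditary H := @src L @` range_in H `<=` H.
Definition saturated H :=
  forall v n, @src L @` paths_from v n `<=` H -> H v.

End PathSets.

Section SubKGraph.
Variables (k : nat) (L : kgraph k) (P : set (ob L)) (Q : set (mor L)).
Hypothesis Qrng : forall f, Q f -> P (rng f).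
Hypothesis Qsrc : forall f, Q f -> P (src f).
Hypothesis Qid : forall v, P v -> Q (idm v).
Hypothesis Qcomp : forall f g (e : src f = rng g), Q f -> Q g -> Q (compose e).
Hypothesis Qfact : forall f g (e : src f = rng g), Q (compose e) -> Q f /\ Q g.

Definition sub_rng (f : Q) : P := SigSub (mem_set (Qrng (set_mem (valP f)))).
Definition sub_src (f : Q) : P := SigSub (mem_set (Qsrc (set_mem (valP f)))).
Definition sub_id (v : P) : Q := SigSub (mem_set (Qid (set_mem (valP v)))).
Definition sub_comp (f g : Q) (e : sub_src f = sub_rng g) : Q :=
  SigSub (mem_set (Qcomp (congr1 val e)
                     (set_mem (valP f)) (set_mem (valP g)))).

Fact sub_rng_id v : sub_rng (sub_id v) = v.
Proof. by apply: val_inj; rewrite /= rng_id. Qed.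

Fact sub_src_id v : sub_src (sub_id v) = v.
Proof. by apply: val_inj; rewrite /= src_id. Qed.

Fact sub_rng_comp f g (e : sub_src f = sub_rng g) :
  sub_rng (sub_comp e) = sub_rng f.
Proof. by apply: val_inj; rewrite /= rng_comp. Qed.

Fact sub_src_comp f g (e : sub_src f = sub_rng g) :
  sub_src (sub_comp e) = sub_src g.
Proof. by apply: val_inj; rewrite /= src_comp. Qed.

Fact sub_comp_idl f (e : sub_src (sub_id (sub_rng f)) = sub_rng f) :
  sub_comp e = f.
Proof. by apply: val_inj; rewrite /= comp_idl. Qed.

Fact sub_comp_idr f (e : sub_src f = sub_rng (sub_id (sub_src f))) :
  sub_comp e = f.
Proof. by apply: val_inj; rewrite /= comp_idr. Qed.

Fact sub_comp_assoc f g h (fg : sub_src f = sub_rng g)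
    (gh : sub_src g = sub_rng h) (fgh : sub_src (sub_comp fg) = sub_rng h)
    (fgh' : sub_src f = sub_rng (sub_comp gh)) :
  sub_comp fgh = sub_comp fgh'.
Proof. by apply: val_inj; apply: comp_assoc. Qed.

Definition sub_cat : category :=
  Category sub_rng_id sub_src_id sub_rng_comp sub_src_comp
    sub_comp_idl sub_comp_idr sub_comp_assoc.

Definition sub_deg (f : mor sub_cat) : 'rV[nat]_k := degree (val f).

Fact sub_deg_id (v : ob sub_cat) : sub_deg (idm v) = 0.
Proof. exact: deg_id. Qed.

Fact sub_deg_comp (f g : mor sub_cat) (e : src f = rng g) :
  sub_deg (compose e) = sub_deg f + sub_deg g.
Proof. exact: deg_comp. Qed.

Fact sub_factorisation (l : mor sub_cat) (m n : 'rV[nat]_k) :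
  sub_deg l = m + n ->
  exists! p : mor sub_cat * mor sub_cat,
    [/\ sub_deg p.1 = m, sub_deg p.2 = n &
        exists e : src p.1 = rng p.2, compose e = l].
Proof.
move=> /factorisation[[f g] /= [[fm gn [e fgl]] fg_uniq]].
have /Qfact[Qf Qg] : Q (compose e) by rewrite fgl; exact: set_mem (valP l).
exists (SigSub (mem_set Qf), SigSub (mem_set Qg)); split => /=.
  split=> //; have e' : @src sub_cat (SigSub (mem_set Qf)) =
                       @rng sub_cat (SigSub (mem_set Qg)) by exact: val_inj.
  exists e'; apply: val_inj => /=.
  by rewrite (eq_irrelevance (congr1 val e') e) fgl.
move=> [f' g'] /= [f'm g'n [e' fgl']].
have : (f, g) = (val f', val g').
  by apply: fg_uniq; split=> //; exists (congr1 val e'); rewrite -fgl'.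
by case=> ff' gg'; congr pair; apply: val_inj.
Qed.

Definition sub_kgraph : kgraph k :=
  KGraph sub_deg_id sub_deg_comp sub_factorisation.

End SubKGraph.

Section HereditarySubgraphs.
Variables (k : nat) (L : kgraph k) (H : set (ob L)) (Hh : hereditary H).

Fact hereditary_src f : range_in H f -> H (src f).
Proof. by move=> Hf; apply: Hh; exists f. Qed.

Fact range_in_id v : H v -> range_in H (idm v).
Proof. by rewrite /range_in /= rng_id. Qed.

Fact range_in_comp f g (e : src f = rng g) :
  range_in H f -> range_in H g -> range_in H (compose e).
Proof. by rewrite /range_in /= rng_comp. Qed.

Fact range_in_fact f g (e : src f = rng g) :
  range_in H (compose e) -> range_in H f /\ range_in H g.
Proof.
rewrite /range_in /= rng_comp => Hf; split=> //.
by rewrite -e; exact: hereditary_src.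
Qed.

(* H Lambda: the morphisms with range in H; its vertex type is {v | v \in H}. *)
Definition hereditary_kgraph : kgraph k :=
  @sub_kgraph k L H (range_in H) (fun _ Hf => Hf) hereditary_src range_in_id
    range_in_comp range_in_fact.

Fact source_inC_rng f : (~` source_in H) f -> (~` H) (rng f).
Proof. by move=> nHf Hf; apply: nHf; exact: hereditary_src. Qed.

Fact source_inC_id v : (~` H) v -> (~` source_in H) (idm v).
Proof. by rewrite /source_in /= src_id. Qed.

Fact source_inC_comp f g (e : src f = rng g) :
  (~` source_in H) f -> (~` source_in H) g -> (~` source_in H) (compose e).
Proof. by rewrite /source_in /= src_comp. Qed.

Fact source_inC_fact f g (e : src f = rng g) :
  (~` source_in H) (compose e) -> (~` source_in H) f /\ (~` source_in H) g.
Proof.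
rewrite /source_in /= src_comp => nHg; split=> //.
by rewrite e; exact: source_inC_rng.
Qed.

(* Lambda \ Lambda H: the morphisms whose source is not in H.                *)
Definition quotient_kgraph : kgraph k :=
  @sub_kgraph k L (~` H) (~` source_in H) source_inC_rng (fun _ Hf => Hf)
    source_inC_id source_inC_comp source_inC_fact.

End HereditarySubgraphs.

HB.instance Definition _ (K : choiceType) (M : lmodType int) (f : K -> M) :=
  GRing.isZmodMorphism.Build {freeg K} M (fglift f) (lift_is_additive f).

Section VertexGroup.
Variables (k : nat) (L : kgraph k).

Definition Zvert := {freeg (ob L)}.
HB.instance Definition _ := GRing.Lmodule.on Zvert.

Definition delta (v : ob L) : Zvert := << v >>.

Definition Nvert : set Zvert :=
  [set f | exists (s : seq (ob L)) (c : ob L -> nat),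
             f = \sum_(v <- s) delta v *+ c v].

Definition adjacency (i : 'I_k) (v w : ob L) : nat :=
  #|` fset_set (paths_between v (delta_mx 0 i) w)|.

(* The sum over all vertices w is meaningful for row-finite L, where its     *)
(* support is finite.                                                        *)
Definition adjacency_tr (i : 'I_k) : Zvert -> Zvert :=
  fglift (fun v =>
    \sum_(w \in [set: ob L]) (delta w *+ adjacency i v w) : Zvert).

HB.instance Definition _ i := GRing.Additive.on (adjacency_tr i).

End VertexGroup.

Arguments Nvert {k} L.

Section VertexInclusion.
Variables (k : nat) (L : kgraph k) (H : set (ob L)) (Hh : hereditary H).

Definition ZH_incl : Zvert (hereditary_kgraph Hh) -> Zvert L :=
  fglift (fun v : H => delta (val v)).

HB.instance Definition _ := GRing.Additive.on ZH_incl.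

End VertexInclusion.

Section Cokernel.
Variables (M N : zmodType) (f : {additive M -> N}).

Definition im : {pred N} := mem (range f).

Fact im_zmod_closed : zmod_closed im.
Proof.
split=> [|x y]; first by apply/mem_set; exists 0; rewrite ?raddf0.
move=> /set_mem[a _ <-] /set_mem[b _ <-].
by apply/mem_set; exists (a - b); rewrite ?raddfB.
Qed.

HB.instance Definition _ := GRing.isZmodClosed.Build N im im_zmod_closed.

Definition coker : zmodType := Quotient.quot im.

Definition to_coker : N -> coker := \pi_(Quotient.quot im).

End Cokernel.

Arguments coker {M N} f.
Arguments to_coker {M N} f x.

Section ConditionM.
Variable L : kgraph 2.

Definition one_sub_At (fg : Zvert L * Zvert L) : Zvert L :=
  (fg.1 - adjacency_tr 0 fg.1) + (fg.2 - adjacency_tr 1 fg.2).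

Fact one_sub_At_is_zmod_morphism : zmod_morphism one_sub_At.
Proof.
by move=> [f g] [f' g']; rewrite /one_sub_At /= !raddfB /= !opprD !opprK;
   rewrite [RHS]addrACA; congr (_ + _); rewrite addrACA.
Qed.

HB.instance Definition _ := GRing.isZmodMorphism.Build _ _ one_sub_At
  one_sub_At_is_zmod_morphism.

Definition condition_M := range one_sub_At `&` Nvert L = [set 0].

End ConditionM.

Arguments one_sub_At L fg : clear implicits.

(* Main.v *)
From HB Require Import structures.
Require Import Defs.
From mathcomp Require Import all_boot all_order all_algebra finmap freeg.
From mathcomp Require Import boolp classical_sets functions cardinality fsbigop.
Import GRing.Theory.
Local Open Scope classical_set_scope.
Local Open Scope ring_scope.

(** Write B for the map (1 - A_1^t, 1 - A_2^t) of each of the three graphs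
    [L], [H L] and [L \ L H].  Everything follows from the exact sequence
      0 -> Z H -> Z L^0 -> Z (L^0 \ H) -> 0
    whose maps, the inclusion and the projection killing [H], both commute with
    B ([hereditary_incl_adj], [quotient_proj_adj]) and preserve nonnegativity.
    The sequence is split by the restriction of elements of Z L^0 to [H], which
    is nonnegative as well, so a nonnegative element of Z L^0 that dies in
    Z (L^0 \ H) comes from a nonnegative element of Z H ([quotient_proj_ker],
    [Nvert_restr]).

    The commutation is clearest when A_i^t delta_v is written as the sum of
    delta_(s(l)) over the paths l of degree e_i with range v
    ([adjacency_trE]).  Passing to [H L] or [L \ L H] means keeping only the
    paths of the subgraph ([adjacency_tr_sub]).  For v in [H] none is lost, [H]
    being hereditary; for v outside [H] the paths that are lost end in [H], and
    are exactly those whose sources the projection kills.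

    As the inclusion commutes with B, it induces a map iota of cokernels.  If n
    in N H is sent into the image of the B of [L], then it is sent to 0 by
    condition (M) for [L], so n = 0; this one fact gives both condition (M) for [H L] and the
    triviality of the kernel of iota on the positive cone.  Conversely, let
    x = B(f, g) be nonnegative.  Its projection is a nonnegative value of the
    B of the quotient graph, hence 0, so x comes from some n in N H.  The class
    of n lies in the kernel of iota, so it vanishes by the kernel condition; then
    n is a nonnegative value of the B of [H L], and condition (M) there gives
    n = 0. *)

(** * Free abelian groups on a set and on its subsets *)

Lemma freeg_additive_ext {K : choiceType} {M : zmodType}
    (phi psi : {additive {freeg K} -> M}) :
  (forall v, phi << v >> = psi << v >>) -> phi =1 psi.
Proof.
move=> eq_gen; elim/freeg_ind_dom0 => [|c v D _ _ IH]; first by rewrite !raddf0.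
by rewrite !raddfD /= IH -[c]intz -freegU_mulz !raddfMz eq_gen.
Qed.

Section Restriction.
Variables (T : countType) (P : set T).

Definition freeg_incl : {freeg P} -> {freeg T} :=
  fglift (fun v : P => << val v >> : {freeg T}).
HB.instance Definition _ := GRing.Additive.on freeg_incl.

Definition freeg_restr : {freeg T} -> {freeg P} :=
  fglift (fun v : T => oapp (fun u : P => << u >>) 0 (insub v) : {freeg P}).
HB.instance Definition _ := GRing.Additive.on freeg_restr.

Lemma freeg_inclU (v : P) : freeg_incl << v >> = << val v >>.
Proof. by rewrite /freeg_incl liftU scale1r. Qed.

Lemma freeg_restr_val (v : P) : freeg_restr << val v >> = << v >>.
Proof. by rewrite /freeg_restr liftU scale1r valK. Qed.

Lemma freeg_restr_in (v : T) (Pv : P v) :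
  freeg_restr << v >> = << SigSub (mem_set Pv) : P >>.
Proof. exact: freeg_restr_val (SigSub (mem_set Pv)). Qed.

Lemma freeg_restr_out (v : T) : ~ P v -> freeg_restr << v >> = 0.
Proof.
by move=> nPv; rewrite /freeg_restr liftU scale1r insubN // notin_setE.
Qed.

Lemma freeg_inclK : cancel freeg_incl freeg_restr.
Proof.
apply: (freeg_additive_ext (freeg_restr \o freeg_incl) idfun) => v /=.
by rewrite freeg_inclU freeg_restr_val.
Qed.

End Restriction.
Arguments freeg_incl {T} P.
Arguments freeg_restr {T} P.

Lemma freeg_restr_split (T : countType) (P : set T) (x : {freeg T}) :
  freeg_incl P (freeg_restr P x) + freeg_incl (~` P) (freeg_restr (~` P) x) = x.
Proof.
apply: (freeg_additive_ext ((freeg_incl P \o freeg_restr P) \+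
   (freeg_incl (~` P) \o freeg_restr (~` P))) idfun) => v /=.
have [Pv|nPv] := pselect (P v).
  rewrite (freeg_restr_out _ (~` P)) ?raddf0 ?addr0 //.
  by rewrite freeg_restr_in freeg_inclU.
rewrite freeg_restr_out // raddf0 add0r.
by rewrite (freeg_restr_in _ _ _ (nPv : (~` P) v)) freeg_inclU.
Qed.

(** * The positive cone *)

Section PositiveCone.
Context {k : nat}.

(** Absorbing the coefficients into repetitions of the vertices makes closure of
    the cone under addition mere concatenation. *)
Lemma NvertP (L : kgraph k) (f : Zvert L) :
  Nvert L f <-> exists s : seq (ob L), f = \sum_(v <- s) delta v.
Proof.
split=> [[s [c ->]]|[s ->]]; last by exists s, (fun=> 1%N).
exists (flatten [seq nseq (c v) v | v <- s]).
rewrite big_flatten big_map; apply: eq_bigr => v _.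
by rewrite big_nseq iter_addr_0.
Qed.

Lemma Nvert0 (L : kgraph k) : Nvert L 0.
Proof. by apply/NvertP; exists [::]; rewrite big_nil. Qed.

Lemma Nvert_delta (L : kgraph k) v : Nvert L (delta v).
Proof. by apply/NvertP; exists [:: v]; rewrite big_seq1. Qed.

Lemma Nvert_additive (L L' : kgraph k) (phi : {additive Zvert L -> Zvert L'})
    (f : Zvert L) :
  (forall v, Nvert L' (phi (delta v))) -> Nvert L f -> Nvert L' (phi f).
Proof.
move=> phiN /NvertP[s ->]; rewrite raddf_sum; apply/NvertP.
elim: s => [|v s [t IH]]; first by exists [::]; rewrite !big_nil.
have /NvertP[u Eu] := phiN v.
by exists (u ++ t); rewrite big_cons big_cat Eu IH.
Qed.

End PositiveCone.

(** * Transposed adjacency matrices as sums over paths *)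

(** The multiplicity of delta_w in A_i^t delta_v counts the paths with source w,
    so grouping the paths by their source turns the sum over vertices into a sum
    over paths.  Row-finiteness makes both sums finite. *)
Lemma adjacency_trE (k : nat) (L : kgraph k) (i : 'I_k) (v : ob L) :
  row_finite L ->
  adjacency_tr i (delta v) =
  \sum_(l <- fset_set (paths_from v (delta_mx 0 i))) delta (src l).
Proof.
move=> /(_ v (delta_mx 0 i)) fin; rewrite /adjacency_tr /delta liftU scale1r.
set A := fset_set _.
have adjE w : adjacency i v w = (\sum_(l <- A) (src l == w))%N.
  have -> : adjacency i v w = #|` [fset l in A | src l == w]%fset|.
    congr (#|` _|); apply/fsetP => l.
    rewrite in_fset_set; last exact: finite_setIl.
    rewrite !inE /=; apply/idP/andP; rewrite /A in_fset_set // !inE.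
      by case=> ? /eqP.
    by case=> ? /eqP.
  by rewrite -sum1_size big_fset big_mkcond.
rewrite (fsbigTE [fset src l | l in A]%fset) => [|w]; last first.
  move=> notin_w; rewrite adjE big1_seq // => l /andP[_ Al].
  by apply/eqP; rewrite eqb0; apply: contra notin_w => /eqP <-; exact: in_imfset.
under eq_bigr do rewrite adjE -sumrMnr.
rewrite exchange_big; apply: eq_big_seq => l Al.
(* for a fixed path l, only the vertex w = src l contributes *)
rewrite (big_fsetD1 (src l)) /=; last exact: in_imfset.
rewrite eqxx mulr1n big1_seq ?addr0 // => w; rewrite !inE => /andP[_ /andP[]].
by rewrite eq_sym => /negbTE ->.
Qed.

Lemma one_sub_At_morph (L L' : kgraph 2) (phi : {additive Zvert L -> Zvert L'})
    (fg : Zvert L * Zvert L) :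
  (forall i v, phi (adjacency_tr i (delta v)) = adjacency_tr i (phi (delta v))) ->
  phi (one_sub_At L fg) = one_sub_At L' (phi fg.1, phi fg.2).
Proof.
move=> phiA; have com i : phi \o adjacency_tr i =1 adjacency_tr i \o phi.
  exact: (freeg_additive_ext (phi \o adjacency_tr i) (adjacency_tr i \o phi)
            (phiA i)).
rewrite /one_sub_At /= raddfD !raddfB /=.
by congr (_ - _ + (_ - _)); exact: com.
Qed.

(** * Subgraphs *)

Section SubKGraphTheory.
Variables (k : nat) (L : kgraph k) (P : set (ob L)) (Q : set (mor L)).
Hypothesis Qrng : forall f, Q f -> P (rng f).
Hypothesis Qsrc : forall f, Q f -> P (src f).
Hypothesis Qid : forall v, P v -> Q (idm v).
Hypothesis Qcomp : forall f g (e : src f = rng g), Q f -> Q g -> Q (compose e).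
Hypothesis Qfact : forall f g (e : src f = rng g), Q (compose e) -> Q f /\ Q g.

Let S := sub_kgraph Qrng Qsrc Qid Qcomp Qfact.

Lemma image_paths_from_sub (v : ob S) (n : 'rV[nat]_k) :
  val @` paths_from v n = paths_from (val v : ob L) n `&` Q.
Proof.
apply/seteqP; split=> [_ [f [fn fv] <-]|f [[fn fv] Qf]].
  split; last exact: set_mem (valP f).
  by split; [exact: fn | rewrite -fv].
by exists (SigSub (mem_set Qf)) => //; split; [|exact: val_inj].
Qed.

Lemma row_finite_sub : row_finite L -> row_finite S.
Proof.
move=> Lrf v n.
rewrite -(eq_finite_set (inj_card_eq (in2W val_inj))) image_paths_from_sub.
exact: finite_setIl.
Qed.

(** The right-hand side refers to paths of [L] only, so that a sum over a
    subgraph can be compared termwise with the sum for [L] itself. *)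
Lemma adjacency_tr_sub (i : 'I_k) (v : ob S) : row_finite L ->
  adjacency_tr i (delta v) =
  \sum_(l <- fset_set (paths_from (val v : ob L) (delta_mx 0 i)) | l \in Q)
    freeg_restr P (delta (src l)).
Proof.
move=> Lrf; have Srf := row_finite_sub Lrf; rewrite adjacency_trE //.
set X := fset_set (paths_from (val v) _).
have EX : [fset l in X | l \in Q]%fset =
    [fset val l | l in fset_set (paths_from v (delta_mx 0 i))]%fset.
  rewrite -fset_set_image // image_paths_from_sub; apply/fsetP => l.
  rewrite !inE /= /X !in_fset_set //; last exact: finite_setIl.
  by apply/andP/idP; rewrite !inE.
transitivity
    (\sum_(l <- [fset l in X | l \in Q]%fset) freeg_restr P (delta (src l)));
  last by rewrite big_fset.
rewrite EX big_imfset /= => [|? ? _ _ /val_inj //].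
apply: eq_bigr => l _.
exact: esym (freeg_restr_val _ _ (@src S l : P)).
Qed.

Lemma Nvert_restr (f : Zvert L) :
  Nvert L f -> Nvert S (freeg_restr P f : Zvert S).
Proof.
apply: (@Nvert_additive k L S (freeg_restr P)) => v /=.
have [Pv|nPv] := pselect (P v).
  by rewrite /delta freeg_restr_in; exact: (@Nvert_delta k S).
by rewrite /delta freeg_restr_out //; exact: Nvert0.
Qed.

End SubKGraphTheory.

Section Hereditary.
Variables (k : nat) (L : kgraph k) (H : set (ob L)) (Hh : hereditary H).

Lemma ZH_incl_delta (v : ob (hereditary_kgraph Hh)) :
  ZH_incl (delta v) = delta (val v : ob L).
Proof. exact: freeg_inclU. Qed.

Definition quotient_proj : Zvert L -> Zvert (quotient_kgraph Hh) :=
  freeg_restr (~` H).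
HB.instance Definition _ := GRing.Additive.on quotient_proj.

Lemma quotient_proj_ker (x : Zvert L) :
  quotient_proj x = 0 ->
  x = ZH_incl (freeg_restr H x : Zvert (hereditary_kgraph Hh)).
Proof.
rewrite -{2}(freeg_restr_split _ H x) -[quotient_proj x]/(freeg_restr (~` H) x).
by move=> ->; rewrite raddf0 addr0.
Qed.

Hypothesis Lrf : row_finite L.

(** A path with range in [H] is a path of [H L] and has its source in [H], so
    the sums over paths of [H L] and of [L] have the same terms. *)
Lemma hereditary_incl_adj (i : 'I_k) (v : ob (hereditary_kgraph Hh)) :
  ZH_incl (adjacency_tr i (delta v)) = adjacency_tr i (ZH_incl (delta v)).
Proof.
rewrite ZH_incl_delta /hereditary_kgraph adjacency_tr_sub // raddf_sum.
rewrite adjacency_trE // big_mkcond; apply: eq_big_seq => l.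
rewrite in_fset_set // inE => -[_ lv].
have Hl : range_in H l by rewrite /range_in /= lv; exact: set_mem (valP v).
rewrite (mem_set Hl) {1}/delta (freeg_restr_in _ _ _ (hereditary_src Hh Hl)).
exact: ZH_incl_delta.
Qed.

(** For v in [H] both sides vanish, all the sources being in [H]; for v outside
    [H] the paths missing from the quotient graph have their source in [H] and
    so contribute 0 on the left. *)
Lemma quotient_proj_adj (i : 'I_k) (v : ob L) :
  quotient_proj (adjacency_tr i (delta v)) =
  adjacency_tr i (quotient_proj (delta v)).
Proof.
rewrite adjacency_trE // raddf_sum; have [Hv|nHv] := pselect (H v).
  rewrite /quotient_proj freeg_restr_out // raddf0 big1_seq // => l /andP[_].
  rewrite in_fset_set // inE => -[_ lv].
  apply: freeg_restr_out; apply; apply: (hereditary_src Hh).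
  by rewrite /range_in /= lv.
rewrite /quotient_proj /delta (freeg_restr_in _ _ _ (nHv : (~` H) v)).
rewrite /quotient_kgraph adjacency_tr_sub // [RHS]big_mkcond.
apply: eq_bigr => l _; case: ifPn => //; rewrite notin_setE => Hl.
by apply: freeg_restr_out.
Qed.

End Hereditary.

(** * Cokernels *)

Section Coker.
Context {M N : zmodType}.
Implicit Type f : {additive M -> N}.

Lemma to_coker_is_zmod_morphism f : zmod_morphism (to_coker f).
Proof. by move=> x y; rewrite /to_coker raddfB. Qed.
HB.instance Definition _ f :=
  GRing.isZmodMorphism.Build N (coker f) (to_coker f)
    (to_coker_is_zmod_morphism f).

Lemma to_coker_eq0 f (x : N) : to_coker f x = 0 <-> range f x.
Proof.
rewrite -(raddf0 (to_coker f)) /to_coker; split=> [/eqP|fx].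
  by rewrite -Quotient.idealrBE subr0 => /set_mem.
by apply/eqP; rewrite -Quotient.idealrBE subr0; exact/mem_set.
Qed.

End Coker.

Lemma coker_map_exists (M N M' N' : zmodType) (f : {additive M -> N})
    (f' : {additive M' -> N'}) (phi : {additive N -> N'}) :
  (forall x, range f' (phi (f x))) ->
  exists iota : {additive coker f -> coker f'},
    forall x, iota (to_coker f x) = to_coker f' (phi x).
Proof.
move=> im_phi; pose g (x : coker f) := to_coker f' (phi (repr x)).
have reprK_coker x : to_coker f (repr x) = x by rewrite /to_coker reprK.
have gE x y : to_coker f y = x -> to_coker f' (phi y) = g x.
  rewrite -{1}(reprK_coker x) => /eqP; rewrite -subr_eq0 -raddfB => /eqP.
  move=> /to_coker_eq0[z _ Ez]; apply/eqP; rewrite -subr_eq0 -!raddfB -Ez.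
  by apply/eqP/to_coker_eq0.
have gB : zmod_morphism g.
  move=> x y.
  by rewrite -(gE _ (repr x - repr y)) raddfB ?raddfB /= ?reprK_coker.
pose gM := GRing.isZmodMorphism.Build _ _ g gB.
exists (HB.pack_for {additive coker f -> coker f'} g gM) => x /=.
exact: esym (gE _ _ erefl).
Qed.

(** * Condition (M) for a graph, a hereditary subgraph and its quotient *)

Theorem lemma5p1 (L : kgraph 2) (Lrf : row_finite L) (Lns : no_sources L)
    (H : set (ob L)) (Hh : hereditary H) (Hs : saturated H) :
  let HL := hereditary_kgraph Hh in
  let L_LH := quotient_kgraph Hh in
  let star (iota : coker (one_sub_At HL) -> coker (one_sub_At L)) :=
    [set x | iota x = 0] `&`
      [set to_coker (one_sub_At HL) f | f in Nvert HL] = [set 0] in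
  exists iota : {additive coker (one_sub_At HL) -> coker (one_sub_At L)},
    [/\ forall f : Zvert HL,
          iota (to_coker (one_sub_At HL) f)
            = to_coker (one_sub_At L) (ZH_incl f),
        condition_M L -> condition_M HL /\ star iota &
        condition_M L_LH -> condition_M HL -> star iota -> condition_M L].
Proof.
move=> HL L_LH star.
pose incl : {additive Zvert HL -> Zvert L} := @ZH_incl 2 L H Hh.
pose proj : {additive Zvert L -> Zvert L_LH} := @quotient_proj 2 L H Hh.
have inclA fg : incl (one_sub_At HL fg) = one_sub_At L (incl fg.1, incl fg.2).
  by apply: one_sub_At_morph => i v; apply: hereditary_incl_adj.
have projA fg : proj (one_sub_At L fg) = one_sub_At L_LH (proj fg.1, proj fg.2).
  by apply: one_sub_At_morph => i v; apply: quotient_proj_adj.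
have inclN f : Nvert HL f -> Nvert L (incl f).
  apply: Nvert_additive => v.
  by rewrite /incl /= ZH_incl_delta; exact: Nvert_delta.
have incl_inj : injective incl by exact: can_inj (freeg_inclK _ H).
have [iota iotaE] : exists iota : {additive coker (one_sub_At HL) ->
                                      coker (one_sub_At L)},
    forall x,
      iota (to_coker (one_sub_At HL) x) = to_coker (one_sub_At L) (incl x).
  by apply: coker_map_exists => x; rewrite inclA; eexists.
exists iota; split=> // [ML|Mq MH st].
  (* both conclusions follow from this consequence of condition (M) for L *)
  have posI n : Nvert HL n -> range (one_sub_At L) (incl n) -> n = 0.
    move=> Nn im_n; apply: incl_inj; rewrite raddf0.
    by have : [set 0] (incl n) by rewrite -ML; split=> //; exact: inclN.
  split; apply/seteqP; split=> x.
  - move=> [[fg _ <-] Nx]; apply: posI => //.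
    by rewrite inclA; eexists.
  - by move=> ->; split; [exists 0; rewrite ?raddf0|exact: Nvert0].
  - move=> [ix [n Nn nx]]; rewrite -nx (posI n) ?raddf0 //.
    by apply/to_coker_eq0; rewrite -iotaE nx.
  - move=> ->; split; first by rewrite /= raddf0.
    by exists 0; [exact: Nvert0|rewrite raddf0].
apply/seteqP; split=> [x [[fg _ Ex] Nx]|_ ->]; last first.
  by split; [exists 0; rewrite ?raddf0|exact: Nvert0].
have projx0 : proj x = 0.
  have : [set 0] (proj x); last by [].
  rewrite -Mq; split; last exact: Nvert_restr.
  by rewrite -Ex projA; eexists.
have [n Nn xE] : exists2 n, Nvert HL n & x = incl n.
  by exists (freeg_restr H x); [exact: Nvert_restr|exact: quotient_proj_ker].
have n0 : to_coker (one_sub_At HL) n = 0.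
  have : [set 0] (to_coker (one_sub_At HL) n); last by [].
  rewrite -st; split; last by exists n.
  by rewrite /= iotaE -xE; apply/to_coker_eq0; exists fg.
have : [set 0] n by rewrite -MH; split=> //; exact/to_coker_eq0.
by rewrite xE => ->; rewrite raddf0.
Qed.
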